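(* Let $\Bbbk$ be a field, $S=\Bbbk[x_1,\dots,x_n]$, and let $I(G)\subset S$ be the edge ideal of a finite simple graph $G$ on the vertex set $\{1,\dots,n\}$. Assume there is a basic double G-link $I(G)=gB+\tilde{A}$, where $g$ is a homogeneous form in $S$, $B\subset S$ is a monomial ideal, and $\tilde{A}\subset S$ is a homogeneous ideal. Then there is a basic double G-link $I(G)=fB+A$ (with the same ideal $B$), where $A\subset S$ is a homogeneous ideal and (1) $f=x_{i_1}+\cdots+x_{i_r}$ is a sum of distinct indeterminates of $S$; and (2) $B=I(G)+\mathcal{N}_f$.
   Context: $S=\Bbbk[x_1,\dots,x_n]$ is standard graded, $\Bbbk$ an arbitrary field. The edge ideal of a finite simple graph $G$ with vertex set $\{1,\dots,n\}$ and edge set $E(G)$ is $I(G)=(x_ix_j : \{i,j\}\in E(G))\subset S$. For a vertex $i$ of $G$, $\mathcal{N}(i)$ denotes the set of neighbours of $i$, i.e. the vertices $j$ with $\{i,j\}\in E(G)$. For $f=x_{i_1}+\cdots+x_{i_r}$, $\mathcal{N}_f$ is the ideal $\mathcal{N}_f=\left(x_j : j\in\bigcap_{q=1}^r\mathcal{N}(i_q)\right)\subset S$. Basic double G-link: all ideals are assumed proper, homogeneous, and saturated (with respect to $(x_1,\dots,x_n)$). An ideal is unmixed if all its associated primes have the same height. $S/A$ is generically Gorenstein if $(S/A)_P$ is Gorenstein for all minimal primes $P$ of $A$. Let $A\subset B$ be unmixed ideals of $S$ such that $S/A$ is Cohen--Macaulay and generically Gorenstein and $\operatorname{ht}(A)+1=\operatorname{ht}(B)$.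 Let $f\in S$ be homogeneous of degree $d>0$ with $A:f=A$. Then $C=fB+A$ is called a basic double G-link of degree $d$ of $B$ on $A$; the equation $C=fB+A$ is also called a basic double G-link. *)

(* Defs.v *)
From HB Require Import structures.
From mathcomp Require Import all_boot all_algebra ring_quotient boolp mpoly.

Set Implicit Arguments.
Unset Strict Implicit.
Unset Printing Implicit Defensive.

Import GRing.Theory.
Local Open Scope ring_scope.

(* [idealr R] and [prime_idealr R] consist of proper ideals, by definition. *)

Section Ideals.
Variable R : comNzRingType.
Implicit Types (I J A : {pred R}) (f : R).

Definition ideal_gen (X : R -> Prop) : {pred R} := fun p =>
  `[< exists2 s : seq (R * R),
        forall c, c \in s -> X c.2 & p = \sum_(c <- s) c.1 * c.2 >].

Definition ideal_sum I J : {pred R} := fun p =>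
  `[< exists a b, [/\ a \in I, b \in J & p = a + b] >].

Definition ideal_scale f I : {pred R} := fun p =>
  `[< exists2 b, b \in I & p = f * b >].

Definition ideal_exp I (N : nat) : {pred R} :=
  ideal_gen (fun p => exists2 a : 'I_N -> R,
    forall i, a i \in I & p = \prod_(i < N) a i).

Definition colon A J : {pred R} := fun r =>
  `[< forall s, s \in J -> r * s \in A >].

Definition colon_elt A f : {pred R} := fun r => r * f \in A.

Definition maximal_ideal (M : idealr R) : Prop :=
  forall J : idealr R, {subset M <= J} -> {subset J <= M}.

Definition minimal_prime A (P : prime_idealr R) : Prop :=
  {subset A <= P} /\
  forall Q : prime_idealr R,
    {subset A <= Q} -> {subset Q <= P} -> {subset P <= Q}.

Definition associated_prime A (P : prime_idealr R) : Prop :=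
  exists s : R, forall t, (t \in P) = (t * s \in A).

Definition is_max (D : nat -> Prop) (h : nat) : Prop :=
  D h /\ forall l, D l -> (l <= h)%N.

Definition is_min (D : nat -> Prop) (h : nat) : Prop :=
  D h /\ forall l, D l -> (h <= l)%N.

Definition prime_chain (l : nat) (P : 'I_l.+1 -> prime_idealr R) : Prop :=
  forall i j : 'I_l.+1, (i < j)%N ->
    {subset P i <= P j} /\ ~ {subset P j <= P i}.

Definition krull_dim : nat -> Prop :=
  is_max (fun l => exists P : 'I_l.+1 -> prime_idealr R, prime_chain P).

Definition prime_height (Q : prime_idealr R) : nat -> Prop :=
  is_max (fun l => exists P : 'I_l.+1 -> prime_idealr R,
    prime_chain P /\ P ord_max =i Q).

Definition height A : nat -> Prop :=
  is_min (fun h => exists2 Q : prime_idealr R,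
    {subset A <= Q} & prime_height Q h).

Definition unmixed A : Prop :=
  exists h, forall P : prime_idealr R, associated_prime A P -> prime_height P h.

Definition noetherian : Prop :=
  forall I : idealr R, exists s : seq R, I =i ideal_gen (fun p => p \in s).

Definition local_at (m : idealr R) : Prop :=
  forall J : idealr R, {subset J <= m}.

Definition regular_seq (s : seq R) : Prop :=
  1 \notin ideal_gen (fun p => p \in s) /\
  forall i, (i < size s)%N -> forall y,
    y * s`_i \in ideal_gen (fun p => p \in take i s) ->
    y \in ideal_gen (fun p => p \in take i s).

Definition depth (m : idealr R) : nat -> Prop :=
  is_max (fun l => exists s : seq R,
    [/\ size s = l, {subset s <= m} & regular_seq s]).

Definition cm_local : Prop :=
  noetherian /\
  exists2 m : idealr R, local_at m & exists2 d, depth m d & krull_dim d.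

Definition injective_module (E : lmodType R) : Prop :=
  forall (M N : lmodType R) (i : {linear M -> N}) (h : {linear M -> E}),
    injective i -> exists h' : {linear N -> E}, forall x, h' (i x) = h x.

(* Injective dimension at most d, via an injective resolution of length d
   cut into short exact sequences 0 -> M -> E -> C -> 0. *)
Fixpoint inj_dim_le (d : nat) (M : lmodType R) : Prop :=
  if d is d'.+1 then
    exists (E C : lmodType R) (i : {linear M -> E}) (p : {linear E -> C}),
      [/\ injective_module E,
          injective i,
          (forall c, exists x, p x = c),
          (forall x, p x = 0 <-> exists y, i y = x) &
          inj_dim_le d' C]
  else injective_module M.

Definition gorenstein_local : Prop :=
  [/\ noetherian, (exists m : idealr R, local_at m) &
      exists d, inj_dim_le d (R^o : lmodType R)].

(* phi exhibits L as the localization of R at the prime P; this determines L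
   up to a unique isomorphism of R-algebras. *)
Definition is_localization (P : {pred R}) (L : comNzRingType)
    (phi : {rmorphism R -> L}) : Prop :=
  [/\ forall s, s \notin P -> exists u, phi s * u = 1,
      forall y, exists r s, s \notin P /\ phi s * y = phi r &
      forall r, phi r = 0 -> exists2 s, s \notin P & s * r = 0].

End Ideals.

Definition cohen_macaulay (R : comNzRingType) : Prop :=
  noetherian R /\
  forall M : idealr R, maximal_ideal M ->
    exists (L : comNzRingType) (phi : {rmorphism R -> L}),
      is_localization M phi /\ cm_local L.

Definition image_ideal (R : comNzRingType) (A : idealr R) (P : {pred R}) :
    {pred {ideal_quot A}} := fun q =>
  `[< exists2 p, p \in P & q = \pi_{ideal_quot A}%qT p >].
Arguments image_ideal {R} A P _.

Definition generically_gorenstein (R : comNzRingType) (A : idealr R) : Prop :=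
  forall P : prime_idealr R, minimal_prime A P ->
    exists (L : comNzRingType) (phi : {rmorphism {ideal_quot A} -> L}),
      is_localization (image_ideal A P) phi /\ gorenstein_local L.

Section Polynomials.
Variables (k : fieldType) (n : nat).
Local Notation S := {mpoly k[n]}.
Implicit Types (A B C : {pred S}) (f : S).

Definition homogeneous_ideal A : Prop :=
  forall p, p \in A -> forall d, pihomog mdeg d p \in A.

Definition irrelevant_ideal : {pred S} :=
  ideal_gen (fun p : S => exists i : 'I_n, p = 'X_i).

Definition saturated A : Prop :=
  forall N, {subset colon A (ideal_exp irrelevant_ideal N) <= A}.

Definition monomial_ideal B : Prop :=
  exists X : 'X_{1..n} -> Prop,
    B =i ideal_gen (fun p : S => exists2 m, X m & p = 'X_[m]).

Definition standing A : Prop :=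
  [/\ idealr_closed A, homogeneous_ideal A & saturated A].

Definition basic_double_Glink_of_degree (d : nat) f (B A : idealr S) C : Prop :=
  [/\ [/\ standing A, standing B & standing C],
      [/\ {subset A <= B}, unmixed A & unmixed B],
      [/\ cohen_macaulay {ideal_quot A}, generically_gorenstein A &
          exists h, height A h /\ height B h.+1],
      [/\ (0 < d)%N, f \is d.-homog & colon_elt A f =i A] &
      C =i ideal_sum (ideal_scale f B) A].

Definition basic_double_Glink f (B A : idealr S) C : Prop :=
  exists d, basic_double_Glink_of_degree d f B A C.

Definition edge_ideal (e : rel 'I_n) : {pred S} :=
  ideal_gen (fun p : S => exists i j, e i j /\ p = 'X_i * 'X_j).

Definition var_sum (s : {set 'I_n}) : S := \sum_(i in s) 'X_i.

(* The ideal N_f for f = var_sum s. *)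
Definition common_nbr_ideal (e : rel 'I_n) (s : {set 'I_n}) : {pred S} :=
  ideal_gen (fun p : S => exists2 j, forall i, i \in s -> e i j & p = 'X_j).

End Polynomials.

Arguments edge_ideal k {n} e _.
Arguments common_nbr_ideal k {n} e s _.

(* Main.v *)
Require Import Defs.
From HB Require Import structures.
From mathcomp Require Import all_boot all_algebra ring_quotient boolp mpoly.

(** The edge ideal I is generated in degree 2, which forces deg g = 1; then
    I = g N + A' with N generated by the variables in B, because the degree 2
    part of g B only involves the linear part of B.  For b in B this gives
    g b = g v + a with v in N and a in A', so b - v lies in A' : g = A', which
    is contained in I; hence B = I + N.  Rescaling each variable by its
    coefficient in g is an automorphism of S that preserves monomial ideals
    and carries the sum f of the variables of g to g, so the preimage of A'
    gives a link of B with f in place of g. *)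

Set Implicit Arguments.
Unset Strict Implicit.
Unset Printing Implicit Defensive.

Import GRing.Theory.
Local Open Scope ring_scope.

(** * Ideals given by generators *)

Section IdealGen.
Variable R : comNzRingType.
Implicit Types (X : R -> Prop) (a p q : R).

Lemma ideal_gen0 X : 0 \in ideal_gen X.
Proof. by apply/asboolP; exists [::] => //; rewrite big_nil. Qed.

Lemma ideal_genMD X a p q :
  p \in ideal_gen X -> q \in ideal_gen X -> a * p + q \in ideal_gen X.
Proof.
move=> /asboolP [s sX ->] /asboolP [t tX ->]; apply/asboolP.
exists ([seq (a * c.1, c.2) | c <- s] ++ t) => [c|].
  by rewrite mem_cat => /orP [/mapP [d /sX ? ->]|/tX].
rewrite big_cat big_map /= mulr_sumr; congr (_ + _).
by apply: eq_bigr => c _; rewrite mulrA.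
Qed.

Lemma mem_ideal_gen X p : X p -> p \in ideal_gen X.
Proof.
move=> Xp; apply/asboolP; exists [:: (1, p)]; last by rewrite big_seq1 mul1r.
by move=> c; rewrite inE => /eqP ->.
Qed.

(** [J] is a mere predicate, since the induction is also run on properties such as having a
    decomposition [g * b + a], which come with no [idealr] structure. *)
Lemma ideal_gen_ind X (J : R -> Prop) :
    J 0 -> (forall a p q, J p -> J q -> J (a * p + q)) ->
    (forall p, X p -> J p) ->
  forall p, p \in ideal_gen X -> J p.
Proof.
move=> J0 JMD XJ p /asboolP [s sX ->].
elim: s sX => [|c s IHs] sX; first by rewrite big_nil.
rewrite big_cons; apply: JMD; first by apply/XJ/sX/mem_head.
by apply: IHs => d ds; apply: sX; rewrite inE ds orbT.
Qed.

Lemma ideal_gen_sub X (J : idealr R) :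
  (forall p, X p -> p \in J) -> {subset ideal_gen X <= J}.
Proof.
move=> XJ; apply: ideal_gen_ind => // [|a p q pJ qJ]; first exact: rpred0.
by rewrite rpredD // idealMr.
Qed.

End IdealGen.

Lemma ideal_gen_map (R1 R2 : comNzRingType) (phi : {rmorphism R1 -> R2})
    (X : R1 -> Prop) (Y : R2 -> Prop) :
    (forall x, X x -> phi x \in ideal_gen Y) ->
  forall p, p \in ideal_gen X -> phi p \in ideal_gen Y.
Proof.
move=> XY; apply: ideal_gen_ind => // [|a p q pY qY].
  by rewrite rmorph0 ideal_gen0.
by rewrite rmorphD rmorphM ideal_genMD.
Qed.

(** Serves to transport saturation, which is phrased with powers of the irrelevant ideal. *)
Lemma ideal_exp_map (R : comNzRingType) (phi : {rmorphism R -> R})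
    (I : {pred R}) N :
    {in I, forall x, phi x \in I} ->
  {in ideal_exp I N, forall x, phi x \in ideal_exp I N}.
Proof.
move=> phiI; apply: ideal_gen_map => _ [a aI ->]; apply: mem_ideal_gen.
exists (phi \o a) => [i|]; first exact: phiI.
by rewrite rmorph_prod.
Qed.

(** * Preimages of ideals under ring morphisms *)

Section Preimage.
Variables (R1 R2 : comNzRingType) (phi : {rmorphism R1 -> R2}).

Definition ideal_preim (J : {pred R2}) : {pred R1} := fun x => phi x \in J.

Lemma ideal_preim_closed (J : idealr R2) : idealr_closed (ideal_preim J).
Proof.
split=> [||a u v uJ vJ]; rewrite unfold_in.
- by rewrite rmorph0 rpred0.
- by rewrite rmorph1 idealr1.
by rewrite rmorphD rmorphM rpredD // idealMr.
Qed.

HB.instance Definition _ (J : idealr R2) :=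
  isIdealr.Build R1 (ideal_preim J) (ideal_preim_closed J).

Lemma ideal_preim_prime (J : prime_idealr R2) :
  prime_idealr_closed (ideal_preim J).
Proof. by move=> u v; rewrite unfold_in rmorphM prime_idealrM. Qed.

HB.instance Definition _ (J : prime_idealr R2) :=
  isPrimeIdealrClosed.Build R1 (ideal_preim J) (@ideal_preim_prime J).

End Preimage.

(** * Invariance under ring isomorphisms: Cohen-Macaulay rings, chains of primes, heights *)

Section Isomorphism.
Variables (R1 R2 : comNzRingType).
Variables (phi : {rmorphism R1 -> R2}) (psi : {rmorphism R2 -> R1}).
Hypotheses (phiK : cancel phi psi) (psiK : cancel psi phi).

Lemma noetherian_iso : noetherian R2 -> noetherian R1.
Proof.
move=> noeth I; have [s Is] := noeth (ideal_preim psi I).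
exists (map psi s) => x; apply/idP/idP => [xI|].
  have: phi x \in ideal_gen (fun p => p \in s).
    by rewrite -Is unfold_in phiK.
  rewrite -{2}[x]phiK; apply: ideal_gen_map => y ys.
  by apply/mem_ideal_gen/map_f.
apply: ideal_gen_sub => _ /mapP [y ys ->].
have: y \in ideal_gen (fun p => p \in s) by apply: mem_ideal_gen.
by rewrite -Is.
Qed.

Lemma maximal_ideal_iso (M : idealr R1) :
  maximal_ideal M -> maximal_ideal (ideal_preim psi M : idealr R2).
Proof.
move=> maxM J sMJ y yJ; apply: (maxM (ideal_preim phi J)).
  by move=> x xM; apply: sMJ; rewrite unfold_in phiK.
by rewrite unfold_in psiK.
Qed.

(** The local ring [L] stays the same and the structure map alone changes, so properties of [L] need
    no transport. *)
Lemma is_localization_iso (P1 : {pred R1}) (P2 : {pred R2})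
    (L : comNzRingType) (f : {rmorphism R2 -> L}) :
    (forall x, (x \in P1) = (phi x \in P2)) ->
  is_localization P2 f -> is_localization P1 (f \o phi).
Proof.
move=> eqP [funit ffrac fker]; split=> [x xP|y|x /fker [t tP tx]].
- by apply: funit; rewrite -eqP.
- have [r [t [tP ty]]] := ffrac y.
  by exists (psi r), (psi t); rewrite eqP /= !psiK.
exists (psi t); first by rewrite eqP psiK.
by rewrite -[x]phiK -rmorphM tx rmorph0.
Qed.

Lemma cohen_macaulay_iso : cohen_macaulay R2 -> cohen_macaulay R1.
Proof.
move=> [noeth cm]; split=> [|M maxM]; first exact: noetherian_iso.
have [L [f [floc Lcm]]] := cm _ (maximal_ideal_iso maxM).
exists L, (f \o phi); split=> //; apply: is_localization_iso floc => x.
by rewrite [RHS]unfold_in phiK.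
Qed.

Lemma prime_chain_preim l (P : 'I_l.+1 -> prime_idealr R2) :
  prime_chain P ->
  prime_chain (fun i => ideal_preim phi (P i) : prime_idealr R1).
Proof.
move=> chP i j ij; have [sP nsP] := chP i j ij; split=> [x /sP //|sP'].
by apply: nsP => y yP; rewrite -[y]psiK; apply: sP'; rewrite unfold_in psiK.
Qed.

End Isomorphism.

(** Pulling a prime back along [phi] and [psi] returns it with the same elements, but not as the
    same term of [prime_idealr]. *)
Lemma prime_height_eq (R : comNzRingType) (Q Q' : prime_idealr R) h :
  Q =i Q' -> prime_height Q h -> prime_height Q' h.
Proof.
move=> eqQ [[P [chP maxP]] hmax]; split=> [|l [P' [chP' maxP']]].
  by exists P; split=> // x; rewrite maxP eqQ.
by apply: hmax; exists P'; split=> // x; rewrite maxP' eqQ.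
Qed.

Section IsomorphismInvariants.
Variables (R1 R2 : comNzRingType).
Variables (phi : {rmorphism R1 -> R2}) (psi : {rmorphism R2 -> R1}).
Hypotheses (phiK : cancel phi psi) (psiK : cancel psi phi).

Lemma prime_height_iso (Q : prime_idealr R2) h :
  prime_height Q h -> prime_height (ideal_preim phi Q : prime_idealr R1) h.
Proof.
move=> [[P [chP maxP]] hmax]; split=> [|l [P' [chP' maxP']]].
  exists (fun i => ideal_preim phi (P i) : prime_idealr R1); split.
    exact: prime_chain_preim psiK _ _ chP.
  by move=> x; rewrite !unfold_in; apply: maxP.
apply: hmax; exists (fun i => ideal_preim psi (P' i) : prime_idealr R2).
split; first exact: prime_chain_preim phiK _ _ chP'.
by move=> x; rewrite unfold_in maxP' unfold_in psiK.
Qed.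

End IsomorphismInvariants.

(** * Maps induced on quotient rings *)

Section QuotientMap.
Variables (R1 R2 : comNzRingType) (phi : {rmorphism R1 -> R2}).
Variables (A1 : idealr R1) (A2 : idealr R2).
Hypothesis phiA : {subset A1 <= ideal_preim phi A2}.
Local Notation Q1 := {ideal_quot A1}.
Local Notation Q2 := {ideal_quot A2}.
Local Open Scope quotient_scope.

(** The inclusion is an argument so that the term records why the map is well defined and can carry
    a ring morphism structure. *)
Definition quot_map of {subset A1 <= ideal_preim phi A2} :=
  fun q : Q1 => \pi_Q2 (phi (repr q)).

Lemma quot_map_pi x : quot_map phiA (\pi_Q1 x) = \pi_Q2 (phi x).
Proof.
apply/eqP; rewrite -Quotient.idealrBE -rmorphB; apply: phiA.
by rewrite Quotient.idealrBE reprK.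
Qed.

Lemma quot_map_is_zmod_morphism : zmod_morphism (quot_map phiA).
Proof.
by move=> p q; rewrite -[p]reprK -[q]reprK -rmorphB !quot_map_pi !rmorphB.
Qed.

Lemma quot_map_is_monoid_morphism : monoid_morphism (quot_map phiA).
Proof.
split=> [|p q]; first by rewrite -(rmorph1 \pi_Q1) quot_map_pi !rmorph1.
by rewrite -[p]reprK -[q]reprK -rmorphM !quot_map_pi !rmorphM.
Qed.

HB.instance Definition _ :=
  GRing.isZmodMorphism.Build Q1 Q2 (quot_map phiA) quot_map_is_zmod_morphism.
HB.instance Definition _ :=
  GRing.isMonoidMorphism.Build Q1 Q2 (quot_map phiA)
    quot_map_is_monoid_morphism.

End QuotientMap.

(** * Transport of height, unmixedness and quotient properties of an ideal *)

Section IdealIsomorphism.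
Variables (R1 R2 : comNzRingType).
Variables (phi : {rmorphism R1 -> R2}) (psi : {rmorphism R2 -> R1}).
Hypotheses (phiK : cancel phi psi) (psiK : cancel psi phi).

Lemma height_iso (A : {pred R2}) h :
  height A h -> height (ideal_preim phi A) h.
Proof.
move=> [[Q sAQ htQ] hmin]; split=> [|l [Q' sAQ' htQ']].
  exists (ideal_preim phi Q); first by move=> x xA; apply: sAQ.
  exact: prime_height_iso htQ.
apply: hmin; exists (ideal_preim psi Q'); last exact: prime_height_iso htQ'.
by move=> y yA; apply: sAQ'; rewrite unfold_in psiK.
Qed.

Lemma unmixed_iso (A : {pred R2}) : unmixed A -> unmixed (ideal_preim phi A).
Proof.
move=> [h htA]; exists h => P [s Ps].
have: prime_height (ideal_preim psi P : prime_idealr R2) h.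
  (* If [P] is the colon of the preimage of [A] by [s], its transport to [R2] is the colon of [A] by
     [phi s]. *)
  apply: htA; exists (phi s) => t.
  by rewrite unfold_in Ps unfold_in rmorphM psiK.
move/(prime_height_iso phiK psiK); apply: prime_height_eq => x.
by rewrite !unfold_in phiK.
Qed.

Section Quotient.
Variable A : idealr R2.
Local Notation A1 := (ideal_preim phi A : idealr R1).
Local Notation Q1 := {ideal_quot A1}.
Local Notation Q2 := {ideal_quot A}.

Let phiA : {subset A1 <= ideal_preim phi A}. Proof. by []. Qed.
Let psiA : {subset A <= ideal_preim psi A1}.
Proof. by move=> y yA; rewrite !unfold_in psiK. Qed.

Let quot_mapK : cancel (quot_map phiA) (quot_map psiA).
Proof. by move=> q; rewrite [LHS]quot_map_pi phiK reprK. Qed.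

Let quot_mapKV : cancel (quot_map psiA) (quot_map phiA).
Proof. by move=> q; rewrite [LHS]quot_map_pi psiK reprK. Qed.

Lemma cohen_macaulay_quot_iso : cohen_macaulay Q2 -> cohen_macaulay Q1.
Proof. exact: (cohen_macaulay_iso quot_mapK quot_mapKV). Qed.

(** Minimal primes correspond under the isomorphism, and the localization known for [A] is reused
    along the induced isomorphism of quotients. *)
Lemma generically_gorenstein_iso :
  generically_gorenstein A ->
  generically_gorenstein (ideal_preim phi A : idealr R1).
Proof.
move=> gorA P [sAP minP].
have: minimal_prime A (ideal_preim psi P : prime_idealr R2).
  split=> [y yA|Q sAQ sQP y yP]; first by apply: sAP; rewrite unfold_in psiK.
  rewrite -[y]psiK; apply: (minP (ideal_preim phi Q)) => // [x xA|x xQ].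
    exact: sAQ.
  by rewrite -[x]phiK; apply: sQP.
move=> /gorA [L [f [floc Lgor]]]; exists L, (f \o quot_map phiA); split=> //.
apply: (is_localization_iso quot_mapK quot_mapKV) floc => q.
apply/asboolP/asboolP=> [[p pP ->]|[y yP qy]].
  by exists (phi p); [rewrite unfold_in phiK|exact: quot_map_pi].
by exists (psi y) => //; rewrite -[q]quot_mapK qy; apply: quot_map_pi.
Qed.

End Quotient.
End IdealIsomorphism.

(** * Homogeneous components of a product with a form *)

Lemma pihomogM (k : fieldType) n (g b : {mpoly k[n]}) d i :
  g \is d.-homog -> pihomog mdeg (d + i) (g * b) = g * pihomog mdeg i b.
Proof.
move=> gd; rewrite [b]mpolyE mulr_sumr !linear_sum /= mulr_sumr.
apply: eq_bigr => m _; rewrite -scalerAr !linearZ /= -scalerAr; congr (_ *: _).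
have gm : g * 'X_[m] \is (d + mdeg m).-homog by rewrite dhomogM // dhomogX.
rewrite pihomogX; have [<-|mi] := eqVneq; first exact: pihomog_dE.
by rewrite mulr0; apply: pihomog_ne0 gm; rewrite eqn_add2l.
Qed.

Lemma pihomogM_eq0 (k : fieldType) n (g b : {mpoly k[n]}) d i :
    g \is d.-homog -> {in msupp b, forall m, d + mdeg m != i}%N ->
  pihomog mdeg i (g * b) = 0.
Proof.
move=> gd bi; rewrite [b]mpolyE mulr_sumr linear_sum big_seq big1 //= => m mb.
rewrite -scalerAr linearZ /= (@pihomog_ne0 _ _ _ (d + mdeg m)) ?scaler0 ?bi //.
by rewrite dhomogM // dhomogX.
Qed.

(** * Monomial ideals and edge ideals *)

Section MonomialIdeals.
Variables (k : fieldType) (n : nat).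
Local Notation S := {mpoly k[n]}.

(** The support condition survives sums and multiples, as exponents of a product are sums of
    exponents; conversely each term of [p] is a multiple of a generator. *)
Lemma mem_monomial_gen (X : 'X_{1..n} -> Prop) (p : S) :
  p \in ideal_gen (fun q : S => exists2 m, X m & q = 'X_[m]) <->
  forall m, m \in msupp p -> exists2 m', X m' & (m' <= m)%MM.
Proof.
split=> [|pX].
  move: p; apply: ideal_gen_ind => [m|a p q IHp IHq m|_ [m Xm ->] m'].
  - by rewrite msupp0.
  - move/msuppD_le; rewrite mem_cat => /orP [/msuppM_le|]; last exact: IHq.
    move=> /allpairsP [[m1 m2] [_ /IHp [m' Xm' m'm2] ->]]; exists m' => //=.
    by apply: lepm_trans m'm2 _; apply: lem_addl.
  by rewrite msuppX inE => /eqP ->; exists m => //; apply: lepm_refl.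
rewrite [p]mpolyE big_seq; elim/big_rec: _ => [|m q mp IHq].
  exact: ideal_gen0.
have [m' Xm' m'm] := pX m mp.
rewrite -(submK m'm) mpolyXD scalerAl; apply: ideal_genMD => //.
by apply: mem_ideal_gen; exists m'.
Qed.

Lemma monomial_msupp (B : {pred S}) (p : S) : monomial_ideal B ->
  p \in B <-> forall m, m \in msupp p -> 'X_[m] \in B.
Proof.
move=> [X BX]; rewrite BX mem_monomial_gen; split=> pB m /pB.
  move=> [m' Xm' m'm]; rewrite BX mem_monomial_gen => m''.
  by rewrite msuppX inE => /eqP ->; exists m'.
by rewrite BX mem_monomial_gen; apply; rewrite msuppX inE.
Qed.

Lemma edge_idealE (e : rel 'I_n) : edge_ideal k e =
  ideal_gen (fun p : S => exists2 m : 'X_{1..n},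
    exists i j, e i j /\ m = (U_(i) + U_(j))%MM & p = 'X_[m]).
Proof.
congr ideal_gen; apply/funext => p; apply/propext; split.
  by move=> [i [j [eij ->]]]; exists (U_(i) + U_(j))%MM;
    rewrite ?mpolyXD //; exists i, j.
by move=> [_ [i [j [eij ->]]] ->]; exists i, j; rewrite mpolyXD.
Qed.

Lemma edge_ideal_monomial (e : rel 'I_n) : monomial_ideal (edge_ideal k e).
Proof.
by exists (fun m => exists i j, e i j /\ m = (U_(i) + U_(j))%MM) => p;
  rewrite edge_idealE.
Qed.

(** Some edge monomial with ends [a != b] divides the given one; comparing exponents at [a] and [b]
    forces the pairs to agree up to order. *)
Lemma edge_idealXX (e : rel 'I_n) (i j : 'I_n) :
    ssrbool.symmetric e -> irreflexive e ->
  'X_[U_(i) + U_(j)] \in edge_ideal k e -> e i j.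
Proof.
move=> e_sym e_irr; rewrite edge_idealE mem_monomial_gen msuppX.
move=> /(_ _ (mem_head _ _)) [_ [a [b [eab ->]]] /mnm_lepP le_ab].
have ab : a != b by apply: contraTneq eab => ->; rewrite e_irr.
move: (le_ab a) (le_ab b).
rewrite !mnmDE !mnm1E !eqxx (negbTE ab) [b == a]eq_sym (negbTE ab) addn0.
have [->|_] := eqVneq i a.
  by rewrite (negbTE ab); have [->|] := eqVneq j b.
have [->|//] := eqVneq j a; rewrite (negbTE ab) addn0.
by have [->|//] := eqVneq i b; rewrite e_sym.
Qed.

End MonomialIdeals.

(** * Rescaling the variables *)

Section ScaleVariables.
Variables (k : fieldType) (n : nat).
Local Notation S := {mpoly k[n]}.
Implicit Types (c : 'I_n -> k) (p : S).

Definition scale_vars c : {rmorphism S -> S} :=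
  comp_mpoly [tuple c i *: ('X_i : S) | i < n].

Lemma scale_varsX c m :
  scale_vars c 'X_[m] = (\prod_i c i ^+ m i) *: 'X_[m].
Proof.
rewrite /= comp_mpolyX [in RHS]mpolyXE_id -scaler_prod.
by apply: eq_bigr => i _; rewrite tnth_mktuple exprZn.
Qed.

Lemma scale_varsE c p : scale_vars c p =
  \sum_(m <- msupp p) (p@_m * \prod_i c i ^+ m i) *: 'X_[m].
Proof.
rewrite {1}[p]mpolyE rmorph_sum; apply: eq_bigr => m _ /=.
by rewrite comp_mpolyZ -scalerA -scale_varsX.
Qed.

Lemma mcoeff_scale_vars c p m :
  (scale_vars c p)@_m = p@_m * \prod_i c i ^+ m i.
Proof.
rewrite scale_varsE [in RHS](mpolyE p) !raddf_sum /= mulr_suml.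
apply: eq_bigr => m' _; rewrite !mcoeffZ mcoeffX.
by have [->|_] := eqVneq; rewrite ?mulr0 ?mul0r ?mulr1.
Qed.

Lemma scale_varsK c c' :
  (forall i, c i * c' i = 1) -> cancel (scale_vars c) (scale_vars c').
Proof.
move=> cc' p; apply/mpolyP => m.
rewrite !mcoeff_scale_vars -mulrA -big_split /=.
by rewrite big1 ?mulr1 // => i _; rewrite -exprMn cc' expr1n.
Qed.

Lemma pihomog_scale_vars c d p :
  pihomog mdeg d (scale_vars c p) = scale_vars c (pihomog mdeg d p).
Proof.
rewrite scale_varsE [in RHS](mpolyE p) !linear_sum ?rmorph_sum /=.
apply: eq_bigr => m _; rewrite !linearZ /= pihomogX.
case: ifP => _; last by rewrite comp_mpoly0 !scaler0.
by rewrite -scalerA -scale_varsX.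
Qed.

(** Rescaling is diagonal in the monomial basis, so it never enlarges the support. *)
Lemma scale_vars_monomial c (B : {pred S}) p :
  monomial_ideal B -> p \in B -> scale_vars c p \in B.
Proof.
move=> monB; rewrite !monomial_msupp // => pB m mp; apply: pB.
move: mp; rewrite !mcoeff_msupp mcoeff_scale_vars.
by apply: contraNneq => ->; rewrite mul0r.
Qed.

Lemma scale_vars_irrelevant c p :
  p \in @irrelevant_ideal k n -> scale_vars c p \in @irrelevant_ideal k n.
Proof.
apply: ideal_gen_map => _ [i ->]; rewrite scale_varsX -mul_mpolyC -[_ * _]addr0.
by apply: ideal_genMD; [apply: mem_ideal_gen; exists i|apply: ideal_gen0].
Qed.

(** Zero coefficients are left out so that the sum runs exactly over the variables that will make up
    [f]. *)
Lemma linear_form_sum p : p \is 1.-homog ->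
  p = \sum_(i | p@_U_(i) != 0) p@_U_(i) *: 'X_i.
Proof.
move=> p1; apply/mpolyP => m; rewrite raddf_sum /=.
have [/mdeg1P [j /eqP ->]|m1] := boolP (mdeg m == 1%N); last first.
  rewrite (dhomog_nemf_coeff p1 m1) big1 // => i _; rewrite mcoeffZ mcoeffX.
  by case: (U_(i)%MM =P m) m1 => [<-|_ _]; rewrite ?mdeg1 ?mulr0.
rewrite (eq_bigr (fun i => if i == j then p@_U_(j) else 0)) => [|i _].
  rewrite -big_mkcondr /= (eq_bigl (fun i => (i == j) && (p@_U_(j) != 0))).
    by rewrite big_mkcondr big_pred1_eq; case: eqP => [->|].
  by move=> i; rewrite andbC; case: eqP => [->|].
rewrite mcoeffZ mcoeffX; have [->|ij] := eqVneq i j.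
  by rewrite eqxx mulr1.
by rewrite (negbTE (contra_neq _ ij)) ?mulr0 // => /eqP;
  rewrite eq_mnm1 => /eqP.
Qed.

End ScaleVariables.

(** * Consequences of the given link *)

Section Link.
Variables (k : fieldType) (n : nat) (e : rel 'I_n).
Hypotheses (e_sym : ssrbool.symmetric e) (e_irr : irreflexive e).
Local Notation S := {mpoly k[n]}.
Local Notation I := (edge_ideal k e).
Variables (g : S) (d : nat) (B A : idealr S).
Hypothesis B_monomial : monomial_ideal B.
Hypothesis link : basic_double_Glink_of_degree d g B A I.

Lemma link_colon (x : S) : (g * x \in A) = (x \in A).
Proof. by case: link => _ _ _ [_ _ gA] _; rewrite -[RHS]gA mulrC. Qed.

Lemma link_sub : {subset A <= B}.
Proof. by case: link => _ []. Qed.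

Lemma link_homogeneous : g \is d.-homog.
Proof. by case: link => _ _ _ []. Qed.

Lemma mem_link p :
  p \in I <-> exists b a, [/\ b \in B, a \in A & p = g * b + a].
Proof.
case: link => _ _ _ _ ->.
split=> [/asboolP [_ [a [/asboolP [b bB ->] aA ->]]]|].
  by exists b, a.
move=> [b [a [bB aA ->]]]; apply/asboolP; exists (g * b), a; split=> //.
by apply/asboolP; exists b.
Qed.

Lemma link_mul b : b \in B -> g * b \in I.
Proof. by move=> bB; apply/mem_link; exists b, 0; rewrite addr0 rpred0. Qed.

Lemma link_edge_sub : {subset I <= B}.
Proof.
move=> p /mem_link [b [a [bB aA ->]]].
by rewrite rpredD ?idealMr ?(link_sub aA).
Qed.

Lemma edge_homog i j : 'X_i * 'X_j \is [in k[n], 2.-homog].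
Proof. by rewrite -mpolyXD dhomogX /= mdegD !mdeg1. Qed.

(** Take degree 2 components in ['X_i * 'X_j = g * b + a]; homogeneity of [A] keeps the component of
    [a] in [A]. *)
Lemma link_edge_degree2 i j : e i j ->
  exists b a, [/\ b \in B, a \in A &
    'X_i * 'X_j = pihomog mdeg 2 (g * b) + a :> S].
Proof.
move=> eij; have : 'X_i * 'X_j \in I by apply: mem_ideal_gen; exists i, j.
move=> /mem_link [b [a [bB aA eq_ij]]]; exists b, (pihomog mdeg 2 a).
case: link => [[[_ homA _] _ _] _ _ _ _]; split=> //; first exact: homA.
by rewrite -pihomogD -eq_ij pihomog_dE // edge_homog.
Qed.

Lemma monomial_mdeg_gt0 m : 'X_[m] \in B -> (0 < mdeg m)%N.
Proof.
rewrite lt0n mdeg_eq0; apply: contraTneq => ->.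
by rewrite mpolyX0 idealr1.
Qed.

(** Otherwise a prime over [A] of height [h] would lie over [B], whose height is [h.+1]. *)
Lemma link_not_sub : ~ {subset B <= A}.
Proof.
move=> sBA; case: link => _ _ [_ _ [h [[[Q sAQ Qh] _] [_ Bmin]]]] _ _.
have: (h < h)%N by apply: Bmin; exists Q => // x /sBA /sAQ.
by rewrite ltnn.
Qed.

(* Edge ideals are generated in degree 2, so if d >= 2 the summand g * B would
   contribute nothing to them. *)
Lemma link_degree : d = 1%N.
Proof.
case: link => _ _ _ [d_gt0 _ _] _; apply/eqP; rewrite eqn_leq d_gt0 andbT.
rewrite leqNgt; apply/negP => d_gt1; apply: link_not_sub => b bB.
(* Since [g * b] lies in the edge ideal and [A : g = A], it is enough to show that the edge ideal is
   contained in [A]. *)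
rewrite -link_colon; have := link_mul bB; move: (g * b) => {b bB}.
apply: ideal_gen_sub => _ [i [j [eij ->]]].
have [b [a [bB aA ->]]] := link_edge_degree2 eij.
rewrite (pihomogM_eq0 link_homogeneous) ?add0r // => m mb.
have m_gt0 := monomial_mdeg_gt0 ((monomial_msupp b B_monomial).1 bB m mb).
by rewrite gtn_eqF // (@leq_add 2 1).
Qed.

Definition linear_support : {set 'I_n} := [set i | g@_U_(i) != 0].
Local Notation N := (common_nbr_ideal k e linear_support).

(** If ['X_j] is in [B], then [g * 'X_j] is in the monomial ideal [I], hence so is each of its
    terms. Conversely [g * 'X_j] is in [I], thus equals [g * b + a], and cancelling [g] puts
    ['X_j - b] in [A], inside [B]. *)
Lemma mem_link_var j :
  'X_j \in B <-> forall i, i \in linear_support -> e i j.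
Proof.
split=> [/link_mul gj i|eNj].
  rewrite inE => gi; apply: (edge_idealXX (k := k)) => //.
  apply: (monomial_msupp _ (edge_ideal_monomial k e)).1 gj _ _.
  by rewrite mcoeff_msupp addmC mcoeffMX.
have: g * 'X_j \in I.
  have := link_homogeneous; rewrite link_degree => /linear_form_sum ->.
  rewrite mulr_suml; elim/big_rec: _ => [|i p gi pI]; first exact: ideal_gen0.
  rewrite -scalerAl -mul_mpolyC; apply: ideal_genMD => //.
  by apply: mem_ideal_gen; exists i, j; rewrite eNj // inE.
move=> /mem_link [b [a [bB aA /eqP]]].
rewrite addrC -subr_eq -mulrBr => /eqP ga.
rewrite -[X in X \in _](subrK b) rpredD // link_sub //.
by rewrite -link_colon ga.
Qed.

Lemma link_common_nbr p : p \in I ->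
  exists b a, [/\ b \in N, a \in A & p = g * b + a].
Proof.
move: p.
apply: ideal_gen_ind => [|c p q [b [a [bN aA ->]]] [b' [a' [bN' aA' ->]]]|].
- by exists 0, 0; rewrite ideal_gen0 rpred0 mulr0 addr0.
- exists (c * b + b'), (c * a + a'); rewrite ideal_genMD // rpredD ?idealMr //.
  by split=> //; rewrite !mulrDr mulrCA addrACA.
move=> _ [i [j [eij ->]]]; have [b [a [bB aA ->]]] := link_edge_degree2 eij.
(* As [g] is linear, the degree 2 part of [g * b] is [g] times the linear part of [b]; the variables
   in that part lie in [B], hence in [N]. *)
exists (pihomog mdeg 1 b), a; split=> //; last first.
  rewrite -(pihomogM _ _ (_ : g \is 1.-homog)) //.
  by rewrite -link_degree link_homogeneous.
rewrite pihomogE big_seq_cond; elim/big_rec: _ => [|m p /andP [mb m1] pN].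
  exact: ideal_gen0.
have := (monomial_msupp b B_monomial).1 bB m mb.
have /mdeg1P [j' /eqP ->] := m1 => /mem_link_var eNj'.
rewrite -mul_mpolyC; apply: ideal_genMD => //.
by apply: mem_ideal_gen; exists j'.
Qed.

Lemma link_eq_common_nbr : B =i ideal_sum I N.
Proof.
move=> b; apply/idP/asboolP=> [bB|[p [q [pI qN ->]]]]; last first.
  rewrite rpredD ?(link_edge_sub pI) //.
  apply: ideal_gen_sub qN => _ [j eNj ->].
  exact/mem_link_var.
have [b' [a [bN aA /eqP]]] := link_common_nbr (link_mul bB).
rewrite addrC -subr_eq -mulrBr => /eqP ga.
exists (b - b'), b'; split; rewrite ?subrK //.
(* [b - b'] lies in [A] by cancelling [g], and [A] is contained in [I]. *)
apply/mem_link; exists 0, (b - b'); rewrite mulr0 add0r rpred0.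
by rewrite -link_colon ga.
Qed.

(** An empty support means [g = 0], and then [A : g = A] would put [1] in the proper ideal [A]. *)
Lemma linear_support_neq0 : linear_support != set0.
Proof.
apply/eqP => g0; have: 1 \in A; last by rewrite idealr1.
rewrite -link_colon mulr1.
have := link_homogeneous; rewrite link_degree => /linear_form_sum ->.
rewrite big_pred0 ?rpred0 // => i.
by have := in_set0 i; rewrite -g0 inE.
Qed.

Lemma normalized_link : exists A1 : idealr S,
  basic_double_Glink (var_sum k linear_support) B A1 I.
Proof.
(* The value 1 off the support makes every factor nonzero, so that [sigma] is invertible. *)
pose c i := if i \in linear_support then g@_U_(i) else 1.
have c0 i : c i != 0 by rewrite /c inE; case: ifP => //; rewrite oner_eq0.
pose sigma := scale_vars c; pose tau := scale_vars (fun i => (c i)^-1).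
have sigmaK : cancel sigma tau by apply: scale_varsK => i; rewrite divff.
have tauK : cancel tau sigma by apply: scale_varsK => i; rewrite mulVf.
have sigma_f : sigma (var_sum k linear_support) = g.
  have := link_homogeneous; rewrite link_degree => /linear_form_sum ->.
  rewrite rmorph_sum; apply: eq_big => i; first by rewrite inE.
  move=> si; rewrite scale_varsX (bigD1 i) //= mnm1E eqxx expr1 big1 ?mulr1.
    by rewrite /c si.
  by move=> j ji; rewrite mnm1E eq_sym (negbTE ji) expr0.
have I_monomial := edge_ideal_monomial k e.
exists (ideal_preim sigma A : idealr S), 1%N.
case: (link) => [[[idA homA satA] stB stI] [sAB unA unB]].
move=> [cmA gorA [h [htA htB]]] [_ _ colA] _.
split.
- split=> //; split; first exact: ideal_preim_closed.
    by move=> p pA j; rewrite unfold_in -pihomog_scale_vars; apply: homA.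
  (* Saturation: write [q] as [sigma (tau q)], where [tau q] stays in the same power of the
     irrelevant ideal. *)
  move=> N p /asboolP pN; apply: (satA N); apply/asboolP => q qN.
  rewrite -[q]tauK -rmorphM; apply: pN; apply: ideal_exp_map qN => x.
  exact: scale_vars_irrelevant.
- split=> //; last exact: (unmixed_iso sigmaK tauK unA).
  move=> p /sAB pB; rewrite -[p]sigmaK; exact: scale_vars_monomial.
- split; first exact: (cohen_macaulay_quot_iso sigmaK tauK cmA).
    exact: (generically_gorenstein_iso sigmaK tauK gorA).
  by exists h; split=> //; exact: (height_iso sigmaK tauK htA).
- split=> //.
    by rewrite /var_sum rpred_sum // => i _; rewrite dhomogX /= mdeg1.
  by move=> p; rewrite !unfold_in rmorphM sigma_f; apply: colA.
move=> p; apply/idP/asboolP => [pI|[_ [a [/asboolP [b bB ->] aA ->]]]].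
  (* The monomial ideals [I] and [B] are stable under [sigma] and [tau]: decompose [sigma p] in the
     old link and apply [tau]. *)
  have /mem_link [b [a [bB aA eq_p]]] := scale_vars_monomial c I_monomial pI.
  exists (var_sum k linear_support * tau b), (tau a); split.
  - by apply/asboolP; exists (tau b) => //; apply: scale_vars_monomial.
  - by rewrite unfold_in tauK.
  - by rewrite -[p]sigmaK [sigma p]eq_p rmorphD rmorphM -{1}sigma_f sigmaK.
rewrite -[_ + _]sigmaK; apply: scale_vars_monomial => //.
apply/mem_link; exists (sigma b), (sigma a).
by rewrite rmorphD rmorphM sigma_f; split=> //; apply: scale_vars_monomial.
Qed.

End Link.

Theorem theorem3p5 (k : fieldType) (n : nat) (e : rel 'I_n)
    (e_sym : ssrbool.symmetric e) (e_irr : irreflexive e)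
    (g : {mpoly k[n]}) (B A' : idealr {mpoly k[n]})
    (B_monomial : monomial_ideal B)
    (link : basic_double_Glink g B A' (edge_ideal k e)) :
  exists (s : {set 'I_n}) (A : idealr {mpoly k[n]}),
    [/\ s != set0,
        basic_double_Glink (var_sum k s) B A (edge_ideal k e) &
        B =i ideal_sum (edge_ideal k e) (common_nbr_ideal k e s)].
Proof.
have [d link_d] := link.
have [A linkA] := normalized_link B_monomial link_d.
exists (linear_support g), A; split=> //.
  exact: (linear_support_neq0 B_monomial link_d).
exact: (link_eq_common_nbr e_sym e_irr B_monomial link_d).
Qed.
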